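(* (Duality Theorem) Let $\mathcal{X}$ and $\mathcal{Y}$ be disjoint finite sets and let $Q=\mathcal{Q}(\mathcal{X}\cup\mathcal{Y})$ be colored blue/red so that it contains no blue copy of $\Lambda$. Then $Q$ contains exactly one of the following: (a) a red $\mathcal{X}$-good copy of $\mathcal{Q}(\mathcal{X})$; or (b) a blue $\mathcal{Y}$-shrub.
   Context: $\mathcal{Q}(\mathcal{S})$ is the Boolean lattice of all subsets of $\mathcal{S}$ ordered by inclusion. An embedding of posets is an injective map $f$ with $a\le b$ iff $f(a)\le f(b)$; a copy of a poset is a subset isomorphic to it with inherited order; red/blue copy means all its elements are red/blue. $\Lambda$ is the poset on $Z_1,Z_2,Z_3$ with $Z_1<Z_3$, $Z_2<Z_3$, $Z_1,Z_2$ incomparable. An $\mathcal{X}$-good copy of $\mathcal{Q}(\mathcal{X})$ is the image of an embedding $\phi:\mathcal{Q}(\mathcal{X})\to Q$ with $\phi(X)\cap\mathcal{X}=X$ for all $X\subseteq\mathcal{X}$. An ordered subset of $\mathcal{Y}$ is a (possibly empty) subset with a linear order; $\underline{S}$ is its underlying set; $T\le_{\mathcal{O}}S$ means $T$ is a prefix of $S$. The factorial tree $\mathcal{O}(\mathcal{Y})$ is the poset of all ordered subsets of $\mathcal{Y}$ under $\le_{\mathcal{O}}$. A $\mathcal{Y}$-shrub is the image of an embedding $\tau:\mathcal{O}(\mathcal{Y})\to Q$ with $\tau(S)\cap\mathcal{Y}=\underline{S}$ for all $S\in\mathcal{O}(\mathcal{Y})$. *)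

(* Defs.v *)
From HB Require Import structures.
From mathcomp Require Import all_boot all_order.

Set Implicit Arguments.
Unset Strict Implicit.
Unset Printing Implicit Defensive.

Import Order.TTheory.
Local Open Scope order_scope.

Definition embedding (d d' : Order.disp_t) (P : porderType d)
    (P' : porderType d') (f : P -> P') : Prop :=
  injective f /\ {mono f : a b / a <= b}.

(* P need not be a finType here, so [f @: P] is not available. *)
Definition is_image (A : Type) (B : finType) (f : A -> B) (F : {set B}) : Prop :=
  forall b : B, b \in F <-> exists a : A, f a = b.

Definition is_copy (d d' : Order.disp_t) (P : porderType d)
    (P' : finPOrderType d') (F : {set P'}) : Prop :=
  exists f : P -> P', embedding f /\ is_image f F.
Arguments is_copy {d d'} P {P'} F.

Section BooleanLattice.
Variables (T : finType) (S : {set T}).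

Record bool_lattice : Type :=
  BoolLattice { bl_set :> {set T}; bl_setP : bl_set \subset S }.

HB.instance Definition _ := [isSub for bl_set].
HB.instance Definition _ := [Finite of bool_lattice by <:].

Definition bl_le (A B : bool_lattice) : bool := bl_set A \subset bl_set B.

Fact bl_le_refl : reflexive bl_le.
Proof. by move=> A; apply: subxx. Qed.

Fact bl_le_anti : antisymmetric bl_le.
Proof. by move=> A B AB; apply/val_inj/eqP; rewrite eqEsubset. Qed.

Fact bl_le_trans : transitive bl_le.
Proof. by move=> B A C; apply: subset_trans. Qed.

HB.instance Definition _ :=
  Order.Le_isPOrder.Build (Order.Disp tt tt) bool_lattice
    bl_le_refl bl_le_anti bl_le_trans.

Lemma bl_leE (A B : bool_lattice) : (A <= B) = (bl_set A \subset bl_set B).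
Proof. by []. Qed.

End BooleanLattice.

Section FactorialTree.
Variables (T : finType) (Y : {set T}).

(* A subset of Y with a linear order on it is encoded as the duplicate-free
   list of its elements in increasing order. *)
Record ordered_subset : Type :=
  OrderedSubset { os_seq :> seq T; os_seqP : uniq os_seq && all [in Y] os_seq }.

HB.instance Definition _ := [isSub for os_seq].
HB.instance Definition _ := [Choice of ordered_subset by <:].

Definition underlying (s : ordered_subset) : {set T} := [set y in os_seq s].

Definition os_le (s t : ordered_subset) : bool := prefix s t.

Fact os_le_refl : reflexive os_le.
Proof. by move=> s; apply: prefix_refl. Qed.

Fact os_le_anti : antisymmetric os_le.
Proof.
move=> s t /andP[/prefixP[u ut] /prefixP[v vs]]; apply: val_inj => /=.
case: u ut => [|x u] ut; first by rewrite ut cats0.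
have := congr1 size ut; have := congr1 size vs.
by rewrite !size_cat /= => -> /eqP; rewrite -addnA -[X in X == _]addn0
  eqn_add2l addnS.
Qed.

Fact os_le_trans : transitive os_le.
Proof. by move=> t s u; apply: prefix_trans. Qed.

HB.instance Definition _ :=
  Order.Le_isPOrder.Build (Order.Disp tt tt) ordered_subset
    os_le_refl os_le_anti os_le_trans.

Lemma os_leE (s t : ordered_subset) : (s <= t) = prefix s t.
Proof. by []. Qed.

End FactorialTree.

Variant Lambda : Type := Z1 | Z2 | Z3.

Definition Lambda_code (z : Lambda) : 'I_3 :=
  match z with Z1 => inord 0 | Z2 => inord 1 | Z3 => inord 2 end.
Definition Lambda_decode (i : 'I_3) : Lambda :=
  match val i with 0 => Z1 | 1 => Z2 | _ => Z3 end.
Fact Lambda_codeK : cancel Lambda_code Lambda_decode.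
Proof. by case; rewrite /Lambda_decode /= inordK. Qed.

HB.instance Definition _ := Finite.copy Lambda (can_type Lambda_codeK).

Definition Lambda_le (z z' : Lambda) : bool :=
  match z, z' with
  | Z1, Z1 | Z2, Z2 | _, Z3 => true
  | _, _ => false
  end.

Fact Lambda_le_refl : reflexive Lambda_le. Proof. by case. Qed.
Fact Lambda_le_anti : antisymmetric Lambda_le. Proof. by do 2!case. Qed.
Fact Lambda_le_trans : transitive Lambda_le. Proof. by do 3!case. Qed.

HB.instance Definition _ :=
  Order.Le_isPOrder.Build (Order.Disp tt tt) Lambda
    Lambda_le_refl Lambda_le_anti Lambda_le_trans.

Lemma Lambda_leE (z z' : Lambda) : (z <= z') = Lambda_le z z'.
Proof. by []. Qed.

Variant color : Type := Red | Blue.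

Definition monochromatic (Q : finType) (c : Q -> color) (k : color)
    (F : {set Q}) : Prop :=
  forall A : Q, A \in F -> c A = k.

Definition is_good_copy (T : finType) (X U : {set T})
    (F : {set bool_lattice U}) : Prop :=
  exists phi : bool_lattice X -> bool_lattice U,
    [/\ embedding phi,
        forall A : bool_lattice X, bl_set (phi A) :&: X = bl_set A
      & is_image phi F].
Arguments is_good_copy {T} X {U} F.

Definition is_shrub (T : finType) (Y U : {set T})
    (F : {set bool_lattice U}) : Prop :=
  exists tau : ordered_subset Y -> bool_lattice U,
    [/\ embedding tau,
        forall s : ordered_subset Y, bl_set (tau s) :&: Y = underlying s
      & is_image tau F].
Arguments is_shrub {T} Y {U} F.

(* Main.v *)
(** For the existence part, try to build the shrub greedily: a pair (P, A) with
    P a subset of Y and A a subset of X is extendable if A can be enlarged to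
    some A' such that A' :|: P is blue and (y |: P, A') is extendable for
    every y in Y :\: P. If (set0, set0) is extendable, iterating the choice of
    A' gives a monotone blue map on the ordered subsets of Y, which is an
    embedding because the blue sets below a blue set form a chain.
    Otherwise, whenever (P, A) is not extendable and A :|: P is blue, some
    y = escape P A leaves (y |: P, A) non-extendable. Let r be accessible from
    A if each new element of r is the escape of the part P preceding it at some
    A1 \subset A that is minimal with this part accessible and A1 :|: P blue.
    The union B of all r accessible from A increases with A, and A :|: B is
    red: were it blue, the blue sets below it would form a chain, so the
    escapes would be unambiguous, B would be the longest accessible r, and r
    could be prolonged.
    For exclusiveness, follow a branch s of the shrub tau, adding to s an
    element of phi (tau s :&: X) not yet in s; when none is left,
    phi (tau s :&: X) = tau s is both red and blue. *)
Require Import Defs.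
From mathcomp Require Import all_boot all_order.

Set Implicit Arguments.
Unset Strict Implicit.
Unset Printing Implicit Defensive.

Import Order.TTheory.

(** * Extendable pairs and greedy stems *)

Section Extendable.
Variables (T : finType) (X Y : {set T}) (blue : {set T} -> bool).
Implicit Types (A B P : {set T}) (r s t : seq T).

(* The first argument is fuel. *)
Fixpoint extendable_rec n P A : bool :=
  if n is m.+1 then
    [exists A' : {set T}, [&& A \subset A', A' \subset X, blue (A' :|: P)
      & [forall y in Y :\: P, extendable_rec m (y |: P) A']]]
  else false.

Definition extendable P A := extendable_rec #|Y :\: P|.+1 P A.

Definition extension P A A' :=
  [&& A \subset A', A' \subset X, blue (A' :|: P)
    & [forall y in Y :\: P, extendable (y |: P) A']].

(** Each added [y] lowers [#|Y :\: P|] by one, so the fuel left for a recursive call is exactly what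
    [extendable] gives to [y |: P]. *)
Lemma extendableE P A : extendable P A = [exists A', extension P A A'].
Proof.
rewrite /extendable /=; apply: eq_existsb => A'; do 3!congr (_ && _).
apply: eq_forallb => y; case yYP: (y \in Y :\: P) => //=.
suff -> : #|Y :\: P| = #|Y :\: (y |: P)|.+1 by [].
rewrite (cardsD1 y) yYP add1n; congr _.+1; apply: eq_card => z.
by rewrite !inE negb_or andbA.
Qed.

Lemma extendable_anti P A A' :
  A \subset A' -> extendable P A' -> extendable P A.
Proof.
move=> AA'; rewrite !extendableE => /existsP[B /and4P[A'B BX Bb Be]].
by apply/existsP; exists B; apply/and4P; split=> //; apply: subset_trans A'B.
Qed.

Definition extend P A := odflt A [pick A' | extension P A A'].

Lemma extendP P A : extendable P A -> extension P A (extend P A).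
Proof.
rewrite extendableE /extend => /existsP[A' A'P].
by case: pickP => //= /(_ A'); rewrite A'P.
Qed.

(* Sequences are read backwards: the head is the element added last. *)
Fixpoint stem r : {set T} :=
  if r is y :: r' then extend [set:: r] (stem r') else extend set0 set0.

(** The last clause carries the induction: it provides the extendable pair at which the next
    [extend] is taken. *)
Lemma stem_extension r : extendable set0 set0 -> uniq r -> {subset r <= Y} ->
  [/\ stem r \subset X, blue (stem r :|: [set:: r]),
      stem (behead r) \subset stem r
    & {in Y :\: [set:: r], forall y, extendable (y |: [set:: r]) (stem r)}].
Proof.
move=> e0; elim: r => [|y r IHr] /=.
  move=> _ _; rewrite set_nil.
  have /and4P[_ ? ? /forall_inP ?] := extendP e0.
  by split.
case/andP=> yr ur ryY.
have [||_ _ _ e] := IHr => //; first by move=> z zr; rewrite ryY // inE zr orbT.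
rewrite set_cons.
have /e/extendP/and4P[? ? ? /forall_inP ?] : y \in Y :\: [set:: r].
  by rewrite !inE yr ryY ?mem_head.
by split.
Qed.

(** * Escapes and accessible sequences *)

Definition escape P A := [pick y in Y :\: P | ~~ extendable (y |: P) A].

Lemma escapeP P A y :
  escape P A = Some y -> y \in Y :\: P /\ ~~ extendable (y |: P) A.
Proof. by rewrite /escape; case: pickP => // z /andP[zYP ez] [<-]. Qed.

(** If nothing escaped, [A] itself would witness that [(P, A)] is extendable. *)
Lemma escape_exists P A : A \subset X -> ~~ extendable P A ->
  blue (A :|: P) -> exists y, escape P A = Some y.
Proof.
move=> AX neA bA; rewrite /escape; case: pickP => [y _|none]; first by exists y.
case/negP: neA; rewrite extendableE; apply/existsP; exists A.
rewrite /extension subxx AX bA /=; apply/forall_inP => y yYP.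
by have := none y; rewrite yYP => /negbFE.
Qed.

(* As in [stem], the head of the sequence is the element added last. *)
Fixpoint accessible r A : bool :=
  if r is y :: r' then
    [exists A1 : {set T}, [&& A1 \subset A,
      minset (fun B => accessible r' B && blue (B :|: [set:: r'])) A1
      & escape [set:: r'] A1 == Some y]]
  else true.

Lemma accessible_sub r A A' : A \subset A' -> accessible r A -> accessible r A'.
Proof.
case: r => //= y r AA' /existsP[A1 /and3P[A1A ? ?]].
by apply/existsP; exists A1; apply/and3P; split=> //; apply: subset_trans AA'.
Qed.

Lemma accessible_consP y r A : accessible (y :: r) A -> exists A1,
  [/\ A1 \subset A,
      minset (fun B => accessible r B && blue (B :|: [set:: r])) A1,
      accessible r A1, blue (A1 :|: [set:: r])
    & escape [set:: r] A1 = Some y].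
Proof.
move=> /existsP[A1 /and3P[A1A A1min /eqP esc]]; exists A1.
by have /andP[] := minsetp A1min.
Qed.

Lemma accessible_uniq r A : accessible r A -> uniq r && all [in Y] r.
Proof.
elim: r A => //= y r IHr A /accessible_consP[A1 [_ _ /IHr/andP[-> ->] _]].
by move=> /escapeP[]; rewrite !inE => /andP[-> ->].
Qed.

Lemma accessible_unextendable r A :
  ~~ extendable set0 set0 -> accessible r A -> ~~ extendable [set:: r] A.
Proof.
move=> ne0; case: r => [_|y r /accessible_consP[A1 [A1A _ _ _ /escapeP[_]]]].
  by apply: contra ne0; rewrite set_nil; apply: extendable_anti (sub0set A).
by rewrite set_cons; apply: contra; apply: extendable_anti.
Qed.

Lemma accessible_drop k r A : accessible r A -> accessible (drop k r) A.
Proof.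
elim: r k => [|y r IHr] [|k] //= /accessible_consP[A1 [A1A _ rA1 _ _]].
by apply: IHr; apply: accessible_sub rA1.
Qed.

(** The bound makes the index type finite and, by [accessible_size], excludes no accessible
    sequence. *)
Definition accessible_union A : {set T} :=
  \bigcup_(r : {bseq #|T| of T} | accessible r A) [set:: r].

Lemma uniq_size_card r : uniq r -> size r <= #|T|.
Proof. by move/card_uniqP <-; apply: max_card. Qed.

Lemma accessible_size r A : accessible r A -> size r <= #|T|.
Proof. by case/accessible_uniq/andP=> /uniq_size_card. Qed.

Lemma accessible_unionP r A :
  accessible r A -> [set:: r] \subset accessible_union A.
Proof.
move=> rA; rewrite /accessible_union.
by rewrite (bigD1 (Bseq (accessible_size rA))) //= subsetUl.
Qed.

Lemma accessible_union_mono A A' : A \subset A' ->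
  accessible_union A \subset accessible_union A'.
Proof.
move=> AA'; apply/bigcupsP => r /(accessible_sub AA').
exact: accessible_unionP.
Qed.

Lemma accessible_union_sub A : accessible_union A \subset Y.
Proof.
apply/bigcupsP => r /accessible_uniq/andP[_ /allP rY].
by apply/subsetP => y; rewrite inE => /rY.
Qed.

(** * Accessible sequences under the chain condition on blue sets *)

Hypothesis disjXY : [disjoint X & Y].
Hypothesis blue_chain : forall Z1 Z2 Z3 : {set T},
  blue Z1 -> blue Z2 -> blue Z3 -> Z1 \subset Z3 -> Z2 \subset Z3 ->
  (Z1 \subset Z2) || (Z2 \subset Z1).

Lemma subset_restr A B P P' : A \subset X -> P \subset Y -> P' \subset Y ->
  A :|: P \subset B :|: P' -> A \subset B.
Proof.
move=> AX PY P'Y /subsetP sub; apply/subsetP => x xA.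
have /setUP[//|/(subsetP P'Y) xY] : x \in B :|: P' by rewrite sub // inE xA.
by have /disjointFr := disjXY => /(_ x (subsetP AX x xA)); rewrite xY.
Qed.

(** The minimal sets behind [x] and [y], each joined with [r], lie below one blue set, hence are
    comparable; minimality makes them equal, and [escape] is a function. *)
Lemma accessible_head_inj x y r A : A \subset X ->
  blue (A :|: accessible_union A) ->
  accessible (x :: r) A -> accessible (y :: r) A -> x = y.
Proof.
move=> AX bA /accessible_consP[A1 [A1A min1 r1 b1 esc1]].
move=> /accessible_consP[A2 [A2A min2 r2 b2 esc2]].
have rB : [set:: r] \subset accessible_union A.
  exact/accessible_unionP/(accessible_sub A1A).
have rY := subset_trans rB (accessible_union_sub A).
suff A12 : A1 = A2 by move: esc2; rewrite -A12 esc1 => -[].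
have := blue_chain b1 b2 bA (setUSS A1A rB) (setUSS A2A rB).
case/orP=> /subset_restr sub.
  by apply: (minsetinf min2); rewrite ?r1 // sub // (subset_trans A1A).
by apply/esym/(minsetinf min1); rewrite ?r2 // sub // (subset_trans A2A).
Qed.

Lemma accessible_inj r s A : A \subset X -> blue (A :|: accessible_union A) ->
  accessible r A -> accessible s A -> size r = size s -> r = s.
Proof.
move=> AX bA; elim: r s => [|x r IHr] [|y s] // xr ys [] eq_sz.
have rs : r = s.
  by apply: IHr => //; [have := accessible_drop 1 xr | have := accessible_drop 1 ys];
    rewrite /= drop0.
by rewrite rs in xr *; rewrite (accessible_head_inj AX bA xr ys).
Qed.

Lemma accessible_union_red A : ~~ extendable set0 set0 -> A \subset X ->
  ~~ blue (A :|: accessible_union A).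
Proof.
move=> ne0 AX; apply/negP => bA.
case: (@arg_maxnP _ ([bseq] : {bseq #|T| of T})
  (fun r : {bseq #|T| of T} => accessible r A)
  (fun r : {bseq #|T| of T} => size r)) => // r rA r_max.
have maxr s : accessible s A -> size s <= size r.
  by move=> sA; apply: (r_max (Bseq (accessible_size sA))).
have eqB : accessible_union A = [set:: r].
  apply/eqP; rewrite eqEsubset accessible_unionP // andbT.
  apply/bigcupsP => s sA; apply/subsetP => y; rewrite !inE.
  (* The tail of [r] as long as [s] is accessible, hence equal to [s]. *)
  rewrite (_ : bseqval s = drop (size r - size s) r); first exact: mem_drop.
  apply: (accessible_inj AX bA sA); first exact: accessible_drop.
  by rewrite size_drop subKn // maxr.
rewrite eqB in bA.
have [|A1 A1min A1A] := @minset_exists _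
  (fun B => accessible r B && blue (B :|: [set:: r])) A; first by rewrite rA.
have /andP[r1 b1] := minsetp A1min.
have [y esc] :=
  escape_exists (subset_trans A1A AX) (accessible_unextendable ne0 r1) b1.
have /maxr : accessible (y :: r) A.
  by apply/existsP; exists A1; rewrite A1A A1min esc eqxx.
by rewrite /= ltnn.
Qed.

(** * Blue branches indexed by ordered subsets *)

Definition branch s := stem (rev s) :|: [set:: s].

Hypothesis ext0 : extendable set0 set0.

(** Reversal reconciles [stem], whose head is the newest element, with ordered subsets, which grow
    at the end. *)
Lemma stem_rev s : uniq s && all [in Y] s ->
  [/\ stem (rev s) \subset X, blue (branch s) & [set:: s] \subset Y].
Proof.
case/andP=> us /allP sY.
have [||? b _ _] := stem_extension ext0 (r := rev s); rewrite ?rev_uniq //.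
  by move=> y; rewrite mem_rev => /sY.
split=> //; last by apply/subsetP => y; rewrite inE => /sY.
suff -> : branch s = stem (rev s) :|: [set:: rev s] by [].
by congr (_ :|: _); apply/setP => y; rewrite !inE mem_rev.
Qed.

Lemma mem_branch s y : uniq s && all [in Y] s -> y \in Y ->
  (y \in branch s) = (y \in s).
Proof.
move=> /stem_rev[sX _ _] yY; rewrite !inE; case sy: (y \in stem _) => //=.
have /disjointFr := disjXY => /(_ y (subsetP sX y sy)).
by rewrite yY.
Qed.

Lemma branch_cat s t : uniq (s ++ t) && all [in Y] (s ++ t) ->
  branch s \subset branch (s ++ t).
Proof.
elim/last_ind: t => [|t y IHt]; first by rewrite cats0.
rewrite -rcons_cat => /andP[us /allP sY].
have [||_ _ sub _] := stem_extension ext0 (r := rev (rcons (s ++ t) y)).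
- by rewrite rev_uniq.
- by move=> z; rewrite mem_rev => /sY.
apply: subset_trans (IHt _) _.
  move: us; rewrite rcons_uniq => /andP[_ ->] /=.
  by apply/allP => z zst; rewrite sY // mem_rcons inE zst orbT.
rewrite /branch; rewrite rev_rcons in sub *; apply: setUSS sub _.
by apply/subsetP => z; rewrite !inE mem_rcons inE orbC => ->.
Qed.

(** To reflect inclusion, compare the last element [a] of the smaller sequence with the element [b]
    of [t] at the same place. Both prolonged branches lie in [branch t], so one contains the other,
    and their traces on [Y] force [a = b]. *)
Lemma branch_mono s t : uniq s && all [in Y] s -> uniq t && all [in Y] t ->
  (branch s \subset branch t) = prefix s t.
Proof.
move=> sY tY; apply/idP/idP; last first.
  by case/prefixP=> u ut; rewrite ut in tY *; apply: branch_cat.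
elim/last_ind: s sY => [|s a IHs] saY sub; first exact: prefix0s.
have sY : uniq s && all [in Y] s.
  by move: saY; rewrite rcons_uniq all_rcons => /andP[/andP[_ ->] /andP[_ ->]].
have [a_s aY] : a \notin s /\ a \in Y.
  by move: saY; rewrite rcons_uniq all_rcons => /andP[/andP[-> _] /andP[-> _]].
have : prefix s t.
  apply: IHs => //; apply: subset_trans sub.
  by rewrite -cats1 branch_cat // cats1.
case/prefixP=> -[|b u] ut; rewrite ut in tY sub *.
  have := subsetP sub a; rewrite !mem_branch //.
  by rewrite cats0 (negPf a_s) mem_rcons mem_head => /(_ isT).
rewrite -cat_rcons in tY sub *.
have sbY : uniq (rcons s b) && all [in Y] (rcons s b).
  by move: tY; rewrite cat_uniq all_cat => /andP[/andP[-> _] /andP[-> _]].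
have [b_s bY] : b \notin s /\ b \in Y.
  by move: sbY; rewrite rcons_uniq all_rcons => /andP[/andP[-> _] /andP[-> _]].
have [[[_ b1 _] [_ b2 _]] [_ b3 _]] := (stem_rev saY, stem_rev sbY, stem_rev tY).
suff ab : a = b by rewrite ab prefix_prefix.
case/orP: (blue_chain b1 b2 b3 sub (branch_cat tY)) => /subsetP.
  move=> /(_ a); rewrite !mem_branch // !mem_rcons mem_head => /(_ isT).
  by rewrite inE (negPf a_s) orbF => /eqP.
move=> /(_ b); rewrite !mem_branch // !mem_rcons mem_head => /(_ isT).
by rewrite inE (negPf b_s) orbF => /eqP.
Qed.

End Extendable.

(** * Passage between plain sets and the colored lattice *)

Section Duality.
Variables (T : finType) (X Y : {set T}).
Local Notation Q := (bool_lattice (X :|: Y)).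
Variable c : Q -> color.

Definition is_blue k := if k is Blue then true else false.

(** Sets not contained in [X :|: Y] count as not blue. *)
Definition blue_set (Z : {set T}) : bool :=
  if insub Z is Some z then is_blue (c z) else false.

Lemma blue_setE (z : Q) : blue_set (bl_set z) = is_blue (c z).
Proof. by rewrite /blue_set (valK z). Qed.

Lemma blue_set_sub Z : blue_set Z -> exists2 z : Q, bl_set z = Z & c z = Blue.
Proof.
rewrite /blue_set; case: insubP => // z _ <-.
by case cz: (c z) => // _; exists z.
Qed.

Lemma no_blue_Lambda_chain :
  (~ exists F : {set Q}, is_copy Lambda F /\ monochromatic c Blue F) ->
  forall Z1 Z2 Z3, blue_set Z1 -> blue_set Z2 -> blue_set Z3 ->
  Z1 \subset Z3 -> Z2 \subset Z3 -> (Z1 \subset Z2) || (Z2 \subset Z1).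
Proof.
move=> noL A1 A2 A3 /blue_set_sub[z1 <- c1] /blue_set_sub[z2 <- c2].
move=> /blue_set_sub[z3 <- c3] s13 s23; apply: contraT => /norP[n12 n21].
(* Were [z3] below [z1], then [z2], being below [z3], would be below [z1]; the next line is
   symmetric. *)
have n31 : ~~ (bl_set z3 \subset z1) by apply: contra n21; apply: subset_trans.
have n32 : ~~ (bl_set z3 \subset z2) by apply: contra n12; apply: subset_trans.
pose f z := match z with Z1 => z1 | Z2 => z2 | Z3 => z3 end.
have f_mono : {mono f : a b / (a <= b)%O}.
  case=> -[]; rewrite bl_leE Lambda_leE /= ?subxx //; exact: negbTE.
case: noL; exists [set z1; z2; z3]; split; last first.
  by move=> A; rewrite !inE => /orP[/orP[]|] /eqP ->.
exists f; split.
  split=> // a b ab; apply/le_anti.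
  by rewrite -!f_mono ab lexx.
move=> A; rewrite !inE; split.
  by case/orP=> [/orP[]|] /eqP ->; [exists Z1|exists Z2|exists Z3].
by case=> -[] <-; rewrite eqxx ?orbT.
Qed.

Hypothesis disjXY : [disjoint X & Y].

(** The trace of [A :|: B A] on [X] is [A], so inclusion of images is reflected. *)
Lemma good_copy_of_monotone (B : {set T} -> {set T}) :
  (forall A, B A \subset Y) ->
  (forall A A' : {set T}, A \subset A' -> B A \subset B A') ->
  (forall A : {set T}, A \subset X -> ~~ blue_set (A :|: B A)) ->
  exists F : {set Q}, is_good_copy X F /\ monochromatic c Red F.
Proof.
move=> BY B_mono B_red.
have phiP (A : bool_lattice X) : bl_set A :|: B A \subset X :|: Y.
  by rewrite setUSS ?bl_setP.
pose phi A : Q := BoolLattice (phiP A).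
have phiX A : bl_set (phi A) :&: X = A.
  rewrite /= setIUl (setIidPl (bl_setP A)); apply/setUidPl.
  apply: subset_trans (sub0set _).
  have := disjointWl (BY (bl_set A)) (etrans (disjoint_sym _ _) disjXY).
  by rewrite -setI_eq0 => /eqP ->.
have phi_mono : {mono phi : A A' / (A <= A')%O}.
  move=> A A'; rewrite !bl_leE; apply/idP/idP => [sub|sub].
    by rewrite -(phiX A) -(phiX A') setSI.
  by rewrite setUSS ?B_mono.
exists (phi @: [set: bool_lattice X]); split; last first.
  move=> _ /imsetP[A _ ->]; have := B_red A (bl_setP A).
  by rewrite -[_ :|: _]/(bl_set (phi A)) blue_setE; case: (c _).
exists phi; split=> //.
  split=> // A A' eqA; apply/le_anti.
  by rewrite -!phi_mono eqA lexx.
move=> b; split; first by case/imsetP=> A _ ->; exists A.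
by case=> A <-; apply: imset_f.
Qed.

Lemma shrub_of_mono (g : seq T -> {set T}) :
  (forall s, uniq s && all [in Y] s -> blue_set (g s)) ->
  (forall s y, uniq s && all [in Y] s -> y \in Y -> (y \in g s) = (y \in s)) ->
  (forall s t, uniq s && all [in Y] s -> uniq t && all [in Y] t ->
    (g s \subset g t) = prefix s t) ->
  exists F : {set Q}, is_shrub Y F /\ monochromatic c Blue F.
Proof.
move=> g_blue gY g_mono.
have gU s : uniq s && all [in Y] s -> g s \subset X :|: Y.
  by case/g_blue/blue_set_sub=> z <- _; apply: bl_setP.
pose tau (s : ordered_subset Y) : Q := BoolLattice (gU s (os_seqP s)).
have tau_mono : {mono tau : s t / (s <= t)%O}.
  by move=> s t; rewrite bl_leE os_leE g_mono ?os_seqP.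
(* Sequences of length at most [#|T|] form a finite type that covers all duplicate-free ones. *)
pose F := [set b : Q | [exists s : {bseq #|T| of T},
  [&& uniq s, all [in Y] s & g s == bl_set b]]].
have FP : is_image tau F.
  move=> b; rewrite inE; split.
    case/existsP=> s /and3P[us sY /eqP gs].
    have sP : uniq s && all [in Y] s by rewrite us.
    by exists (OrderedSubset sP); apply: val_inj.
  case=> s <-; have /andP[us sY] := os_seqP s.
  by apply/existsP; exists (Bseq (uniq_size_card us)); rewrite /= us sY eqxx.
exists F; split; last first.
  move=> b /FP[s <-]; have := g_blue s (os_seqP s).
  by rewrite -[g s]/(bl_set (tau s)) blue_setE; case: (c _).
exists tau; split=> //.
  split=> // s t eq_st; apply/le_anti.
  by rewrite -!tau_mono eq_st lexx.
move=> s; apply/setP => y; rewrite !inE; case yY: (y \in Y).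
  by rewrite andbT gY ?os_seqP.
rewrite andbF; apply/esym/negP => ys; have /andP[_ /allP/(_ y ys)] := os_seqP s.
by rewrite yY.
Qed.

(** * Exclusiveness of the two alternatives *)

Lemma good_copy_shrub_meet (F G : {set Q}) :
  is_good_copy X F -> is_shrub Y G -> exists2 z, z \in F & z \in G.
Proof.
case=> phi [[_ phi_mono] phiX imF] [tau [[_ tau_mono] tauY imG]].
pose A s : bool_lattice X := BoolLattice (subsetIr (bl_set (tau s)) X).
(* [phi (A s)] and [tau s] have the same trace on [X]; once their traces on [Y] agree, they are
   equal. *)
have stop s : underlying s \subset phi (A s) ->
    phi (A s) :&: Y \subset underlying s -> exists2 z, z \in F & z \in G.
  move=> sub sup; exists (tau s); last by apply/imG; exists s.
  apply/imF; exists (A s); apply: val_inj => /=.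
  rewrite -[LHS](setIidPl (bl_setP _)) setIUr phiX /=.
  rewrite -[RHS](setIidPl (bl_setP (tau s))) [RHS]setIUr tauY; congr (_ :|: _).
  by apply/eqP; rewrite eqEsubset sup subsetI sub /= -tauY subsetIr.
(* [n] counts the elements of [T] missing from [s], so the walk along the branch ends. *)
suff meet n s : n + size (os_seq s) = #|T| ->
    underlying s \subset phi (A s) -> exists2 z, z \in F & z \in G.
  have nilP : uniq (@nil T) && all [in Y] [::] by [].
  apply: (meet #|T| (OrderedSubset nilP)); first exact: addn0.
  by apply/subsetP => y; rewrite inE.
elim: n s => [|n IHn] s eq_n sub.
all: have [|/subsetPn[y]] := boolP (phi (A s) :&: Y \subset underlying s);
  first exact: stop.
all: rewrite !inE => /andP[y_phi yY] ys; have /andP[us sY] := os_seqP s.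
  (* With [n = 0], a new [y] would give a duplicate-free sequence longer than [#|T|]. *)
  have := uniq_size_card (_ : uniq (y :: s)); rewrite /= ys us => /(_ isT).
  by rewrite -eq_n ltnn.
have syP : uniq (rcons s y) && all [in Y] (rcons s y).
  by rewrite rcons_uniq all_rcons ys us sY yY.
pose sy := OrderedSubset syP.
have A_sub : (A s <= A sy)%O.
  rewrite bl_leE setSI // -bl_leE tau_mono os_leE /=; exact: prefix_rcons.
apply: (IHn sy); first by rewrite size_rcons addnS -addSn.
(* The invariant persists: [y] and [s] lie in [phi (A s)], which only grows along the branch. *)
have phi_sub : bl_set (phi (A s)) \subset phi (A sy).
  by rewrite -bl_leE phi_mono.
apply: subset_trans phi_sub; apply/subsetP => z.
rewrite inE mem_rcons inE => /orP[/eqP -> //|zs].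
by apply: (subsetP sub); rewrite inE.
Qed.

End Duality.

Theorem theorem12 (T : finType) (X Y : {set T}) (hXY : [disjoint X & Y])
    (c : bool_lattice (X :|: Y) -> color)
    (hc : ~ exists F : {set bool_lattice (X :|: Y)},
        is_copy Lambda F /\ monochromatic c Blue F) :
  let good := exists F : {set bool_lattice (X :|: Y)},
        is_good_copy X F /\ monochromatic c Red F in
  let shrub := exists F : {set bool_lattice (X :|: Y)},
        is_shrub Y F /\ monochromatic c Blue F in
  (good \/ shrub) /\ ~ (good /\ shrub).
Proof.
move=> good shrub; split; last first.
  case=> -[F [goodF redF]] [G [shrubG blueG]].
  have [z /redF cz /blueG] := good_copy_shrub_meet goodF shrubG.
  by rewrite cz.
have chain := no_blue_Lambda_chain hc.
have [e0|ne0] := boolP (extendable X Y (blue_set c) set0 set0); [right|left].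
  apply: (@shrub_of_mono _ _ _ c (branch X Y (blue_set c))).
  - by move=> s /(stem_rev e0)[].
  - by move=> s y sP; apply: mem_branch.
  - by move=> s t; apply: branch_mono.
apply: (@good_copy_of_monotone _ _ _ c hXY
  (accessible_union X Y (blue_set c))).
- exact: accessible_union_sub.
- exact: accessible_union_mono.
- by move=> A; apply: accessible_union_red.
Qed.
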